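(* Let $S$ be a semiring. If every subtractive left ideal of $S$ is a direct summand of ${}_SS$, then $S$ is left $k$-Artinian and left $k$-Noetherian.
   Context: A semiring $(S,+,0,\cdot,1)$ consists of a commutative monoid $(S,+,0)$ and a (not necessarily commutative) monoid $(S,\cdot,1)$ with $0\neq 1$, such that $a\cdot 0=0=0\cdot a$, $a(b+c)=ab+ac$ and $(a+b)c=ac+bc$ for all $a,b,c\in S$. A left $S$-semimodule is a commutative monoid $(M,+,0_M)$ with a unital, associative left action of $S$ that is additive in both variables and satisfies $0\cdot m=0_M=s\cdot 0_M$ (i.e., a module, but not necessarily with subtraction); $S$ is a left semimodule ${}_SS$ over itself, and its subsemimodules are the left ideals of $S$. A subsemimodule $L\leq_S M$ is subtractive if $L=\overline{L}$, where $\overline{L}:=\{m\in M\mid m+\ell=\ell' \text{ for some } \ell,\ell'\in L\}$. A subsemimodule $L\leq_S M$ is a direct summand of $M$ if $M=L\oplus K$ for some subsemimodule $K\leq_S M$, i.e. every element of $M$ can be written uniquely as $\ell+k$ with $\ell\in L$, $k\in K$. The semiring $S$ is left $k$-Noetherian (resp. left $k$-Artinian) if every ascending (resp. descending) chain of subtractive left ideals of $S$ terminates, i.e. becomes stationary. *)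

(* Defs.v *)
From HB Require Import structures.
From mathcomp Require Import all_boot all_order all_algebra.
From mathcomp Require Import boolp classical_sets.

Set Implicit Arguments.
Unset Strict Implicit.
Unset Printing Implicit Defensive.

Import GRing.Theory.

Local Open Scope classical_set_scope.
Local Open Scope ring_scope.

(* Subsets are Prop-valued (set M); [in L] is the boolean predicate
   fun m => `[< L m >] expected by the closedness predicates of ssralg. *)
Definition subsemimodule (S : nzSemiRingType) (M : lSemiModType S)
    (L : set M) : Prop :=
  GRing.subsemimod_closed [in L].

Definition subtractive_closure (S : nzSemiRingType) (M : lSemiModType S)
    (L : set M) : set M :=
  [set m | exists l l' : M, [/\ L l, L l' & m + l = l']].

Definition subtractive (S : nzSemiRingType) (M : lSemiModType S)
    (L : set M) : Prop :=
  L = subtractive_closure L.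

Definition direct_sum (S : nzSemiRingType) (M : lSemiModType S)
    (L K : set M) : Prop :=
  forall m : M, exists! lk : M * M, [/\ L lk.1, K lk.2 & m = lk.1 + lk.2].

Definition direct_summand (S : nzSemiRingType) (M : lSemiModType S)
    (L : set M) : Prop :=
  subsemimodule L /\ exists2 K : set M, subsemimodule K & direct_sum L K.

(* S^o is S acting on itself by left multiplication, a *: x = a * x. *)
Definition left_ideal (S : nzSemiRingType) (I : set S^o) : Prop :=
  subsemimodule I.

Definition subtractive_left_ideal (S : nzSemiRingType) (I : set S^o) : Prop :=
  left_ideal I /\ subtractive I.

Definition stationary (T : Type) (I : nat -> set T) : Prop :=
  exists N : nat, forall n : nat, (N <= n)%N -> I n = I N.

Definition left_k_noetherian (S : nzSemiRingType) : Prop :=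
  forall I : nat -> set S^o,
    (forall n : nat, subtractive_left_ideal (I n)) ->
    (forall n : nat, I n `<=` I n.+1) ->
    stationary I.

Definition left_k_artinian (S : nzSemiRingType) : Prop :=
  forall I : nat -> set S^o,
    (forall n : nat, subtractive_left_ideal (I n)) ->
    (forall n : nat, I n.+1 `<=` I n) ->
    stationary I.

(* Main.v *)
Require Import Defs.
From mathcomp Require Import all_boot all_order all_algebra.
From mathcomp Require Import boolp classical_sets.

(** Why the theorem holds.

    Ascending chains.  The union [U] of an ascending chain of subtractive left
    ideals is again one, so it has a complement, and [1 = e + f] accordingly.
    Every [x] in [U] then equals [x e], because [x = x e + x f] and
    [x = x + 0] are two decompositions of [x].  Hence any term of the chain
    that contains [e] is already all of [U]
    ([left_k_noetherian_of_summands]).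

    Descending chains.  The terms have complements, but a complement chosen
    for each term separately need not form a chain.  The key step
    ([extend_complement]) is a modular law: a complement of [I] extends to one
    of any smaller summand [I'].  Subtractivity of [I] replaces the missing
    subtraction there: it puts the [K']-component of an element of [I] back
    into [I].  So a descending chain has an ascending chain of complements,
    which are subtractive like all direct summands
    ([direct_sum_subtractive]) and therefore become stationary by the first
    part; nested ideals with a common complement are equal
    ([direct_sum_cancel]). *)

Set Implicit Arguments.
Unset Strict Implicit.
Unset Printing Implicit Defensive.

Import GRing.Theory.

Local Open Scope classical_set_scope.
Local Open Scope ring_scope.

Section DirectSums.
Variables (S : nzSemiRingType) (M : lSemiModType S).
Implicit Types I K L T : set M.

Lemma subsemimoduleP L :
  subsemimodule L <->
  [/\ L 0, forall x y, L x -> L y -> L (x + y)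
         & forall a x, L x -> L (a *: x)].
Proof.
split=> [[[L0 LD] LZ]|[L0 LD LZ]].
  split=> [|x y Lx Ly|a x Lx]; first exact: set_mem L0.
  - by apply: set_mem; apply: LD; apply: mem_set.
  - by apply: set_mem; apply: LZ; apply: mem_set.
split; first split.
- exact: mem_set.
- by move=> x y /set_mem Lx /set_mem Ly; apply: mem_set; apply: LD.
- by move=> a x /set_mem Lx; apply: mem_set; apply: LZ.
Qed.

Lemma direct_sumP L K :
  direct_sum L K <->
  (forall m, exists l k, [/\ L l, K k & m = l + k]) /\
  (forall l l' k k', L l -> L l' -> K k -> K k' ->
     l + k = l' + k' -> l = l' /\ k = k').
Proof.
split=> [LK|[cover inj] m].
  split=> [m|l l' k k' Ll Ll' Kk Kk' eq_lk].
    by have [[l k] [[/= Ll Kk ->] _]] := LK m; exists l, k.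
  have [lk [_ uniq_lk]] := LK (l + k).
  have def1 : lk = (l, k) by apply: uniq_lk.
  have def2 : lk = (l', k') by apply: uniq_lk.
  by move: def2; rewrite def1 => -[].
have [l [k [Ll Kk ->]]] := cover m.
exists (l, k); split=> // -[l' k'] [/= Ll' Kk' eq_lk].
by have [-> ->] := inj _ _ _ _ Ll Ll' Kk Kk' eq_lk.
Qed.

Lemma direct_sumC L K : direct_sum L K -> direct_sum K L.
Proof.
move=> /direct_sumP[cover inj]; apply/direct_sumP; split=> [m|k k' l l'].
  by have [l [k [Ll Kk ->]]] := cover m; exists k, l; rewrite addrC.
move=> Kk Kk' Ll Ll'; rewrite addrC [RHS]addrC.
by case/(inj _ _ _ _ Ll Ll' Kk Kk').
Qed.

Lemma subtractiveP L : L 0 ->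
  subtractive L <-> (forall m l, L l -> L (m + l) -> L m).
Proof.
move=> L0; split=> [subL m l Ll Lml|subL].
  by rewrite subL; exists l, (m + l).
apply/seteqP; split=> [m Lm|m [l [l' [Ll Ll' ml]]]].
  by exists 0, m; rewrite addr0.
by apply: (subL m l); rewrite // ml.
Qed.

(** If [m + l] lies in [L], then comparing [K]-components shows that [m] has
    none. *)
Lemma direct_sum_subtractive L K :
  subsemimodule L -> subsemimodule K -> direct_sum L K -> subtractive L.
Proof.
move=> /subsemimoduleP[L0 LD _] /subsemimoduleP[K0 _ _] /direct_sumP[cover inj].
apply/subtractiveP => // m l Ll Lml.
have [a [b [La Kb def_m]]] := cover m.
have [||_ b0] := inj (a + l) (m + l) b 0 _ Lml Kb K0; first exact: LD.
  by rewrite addr0 def_m addrAC.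
by rewrite def_m b0 addr0.
Qed.

Lemma direct_sum_cancel L L' T :
  T 0 -> L' `<=` L -> direct_sum L T -> direct_sum L' T -> L = L'.
Proof.
move=> T0 sub_L'L /direct_sumP[_ inj] /direct_sumP[cover' _].
apply/seteqP; split=> // x Lx.
have [l [t [L'l Tt def_x]]] := cover' x.
have [|-> //] := inj x l 0 t Lx (sub_L'L _ L'l) T0 Tt.
by rewrite addr0.
Qed.

(** The new complement is [T + (K' :&: I)], for a complement [K'] of [I']:
    since [I] is subtractive, decomposing its elements along [I'] and [K']
    gives [I = I' (+) (K' :&: I)]. *)
Lemma extend_complement I I' T :
  subsemimodule I -> subtractive I -> subsemimodule T -> direct_sum I T ->
  I' `<=` I -> direct_summand I' ->
  exists T', [/\ subsemimodule T', direct_sum I' T' & T `<=` T'].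
Proof.
move=> /subsemimoduleP[I0 ID IZ] /(subtractiveP I0) subI.
move=> /subsemimoduleP[T0 TD TZ] /direct_sumP[coverI injI] sub_I'I.
move=> [/subsemimoduleP[I'0 I'D I'Z] [K' /subsemimoduleP[K'0 K'D K'Z]]].
move=> /direct_sumP[coverI' injI'].
exists [set m | exists t j, [/\ T t, K' j, I j & m = t + j]]; split.
- apply/subsemimoduleP; split.
  + by exists 0, 0; rewrite addr0.
  + move=> _ _ [t [j [Tt K'j Ij ->]]] [u [h [Tu K'h Ih ->]]].
    by exists (t + u), (j + h); rewrite addrACA; split; auto.
  + move=> a _ [t [j [Tt K'j Ij ->]]].
    by exists (a *: t), (a *: j); rewrite scalerDr; split; auto.
- apply/direct_sumP; split=> [m|l l' k k' I'l I'l'].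
    have [i [t [Ii Tt ->]]] := coverI m.
    have [l [j [I'l K'j def_i]]] := coverI' i.
    exists l, (t + j); split=> //; last by rewrite def_i addrAC addrA.
    exists t, j; split=> //; apply: (subI j l); first exact: sub_I'I.
    by rewrite addrC -def_i.
  move=> [t [j [Tt K'j Ij ->]]] [u [h [Tu K'h Ih ->]]] eq_sum {k k'}.
  have [|||eq_lj ->] := injI (l + j) (l' + h) t u _ _ Tt Tu; auto.
    by rewrite -!addrA ![_ + t]addrC ![_ + u]addrC.
  by have [-> ->] := injI' _ _ _ _ I'l I'l' K'j K'h eq_lj.
- by move=> t Tt; exists t, 0; rewrite addr0.
Qed.

Lemma ascending_union (I : nat -> set M) :
  (forall n, subsemimodule (I n)) -> (forall n, subtractive (I n)) ->
  (forall n, I n `<=` I n.+1) ->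
  subsemimodule (\bigcup_n I n) /\ subtractive (\bigcup_n I n).
Proof.
move=> modI subI incI.
have leI m n : (m <= n)%N -> I m `<=` I n.
  exact: (homo_leq (r := subset) (@subset_refl _) (@subset_trans _) incI).
have common m n x y : I m x -> I n y -> exists p, I p x /\ I p y.
  move=> Ix Iy; exists (maxn m n).
  by split; [apply: (leI m) Ix; apply: leq_maxl
            |apply: (leI n) Iy; apply: leq_maxr].
have U0 : (\bigcup_n I n) 0.
  by exists 0%N => //; case/subsemimoduleP: (modI 0%N).
split.
  apply/subsemimoduleP; split=> // [x y [m _ Ix] [n _ Iy]|a x [n _ Ix]].
    have [p [{}Ix {}Iy]] := common _ _ _ _ Ix Iy.
    by exists p => //; case/subsemimoduleP: (modI p) => _ ID _; apply: ID.
  by exists n => //; case/subsemimoduleP: (modI n) => _ _; apply.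
apply/subtractiveP => // x l [m _ Il] [n _ Ixl].
have [p [{}Il {}Ixl]] := common _ _ _ _ Il Ixl.
have /subsemimoduleP[Ip0 _ _] := modI p.
by exists p => //; apply: ((subtractiveP Ip0).1 (subI p) x l).
Qed.

(** The complements are built one after the other, each extending the
    previous one. *)
Lemma ascending_complements (I : nat -> set M) :
  (forall n, direct_summand (I n)) -> (forall n, subtractive (I n)) ->
  (forall n, I n.+1 `<=` I n) ->
  exists T : nat -> set M,
    [/\ forall n, subsemimodule (T n), forall n, direct_sum (I n) (T n)
      & forall n, T n `<=` T n.+1].
Proof.
move=> sumI subI decI.
pose compl n T := subsemimodule T /\ direct_sum (I n) T.
have [K0 modK0 sumK0] := (sumI 0%N).2.
have step (nT : nat * set M) : exists T', compl nT.1 nT.2 ->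
    compl nT.1.+1 T' /\ nT.2 `<=` T'.
  case: nT => n T /=; have [[modT sumT]|ncT] := pselect (compl n T); last first.
    by exists T => /ncT.
  have [T' [modT' sumT' sTT']] :=
    extend_complement (sumI n).1 (subI n) modT sumT (decI n) (sumI n.+1).
  by exists T'.
have [next nextP] := choice step.
pose T := nat_rect (fun=> set M) K0 (fun n Tn => next (n, Tn)).
have TP n : compl n (T n).
  by elim: n => [//|n IHn]; case: (nextP (n, T n) IHn).
exists T; split=> n; [exact: (TP n).1 | exact: (TP n).2 |].
by case: (nextP (n, T n) (TP n)).
Qed.

End DirectSums.

(** The component [e] of [1] in [U] is a right identity on [U], so a left
    ideal that contains [e] contains all of [U]. *)
Lemma direct_sum_sub_of_unit (S : nzSemiRingType) (U K : set S^o) :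
  left_ideal U -> left_ideal K -> direct_sum U K ->
  exists2 e, U e & forall I : set S^o, left_ideal I -> I e -> U `<=` I.
Proof.
move=> /subsemimoduleP[_ _ UZ] /subsemimoduleP[K0 _ KZ] /direct_sumP[cover inj].
have [e [f [Ue Kf def1]]] := cover 1.
exists e => // I /subsemimoduleP[_ _ IZ] Ie x Ux.
have [|-> _] := inj x (x *: e) 0 (x *: f) Ux (UZ _ _ Ue) K0 (KZ _ _ Kf).
  by rewrite -scalerDr -def1 addr0; apply/esym/mulr1.
exact: IZ.
Qed.

Section SummandSemiring.
Variable S : nzSemiRingType.
Hypothesis hS :
  forall I : set S^o, subtractive_left_ideal I -> direct_summand I.

Lemma left_k_noetherian_of_summands : left_k_noetherian S.
Proof.
move=> I idI incI.
have [modU subU] :=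
  ascending_union (fun n => (idI n).1) (fun n => (idI n).2) incI.
have [_ [K modK sumUK]] := hS (conj modU subU).
have [e [N _ INe] gen_e] := direct_sum_sub_of_unit modU modK sumUK.
exists N => n leNn; apply/seteqP; split=> [x Ix|].
  by apply: (gen_e _ (idI N).1 INe); exists n.
exact: (homo_leq (r := subset) (@subset_refl _) (@subset_trans _) incI).
Qed.

Lemma left_k_artinian_of_summands : left_k_artinian S.
Proof.
move=> I idI decI.
have [T [modT sumT incT]] :=
  ascending_complements (fun n => hS (idI n)) (fun n => (idI n).2) decI.
have idT n : subtractive_left_ideal (T n).
  split; first exact: modT.
  exact: direct_sum_subtractive (modT n) (idI n).1 (direct_sumC (sumT n)).
have [N statT] := left_k_noetherian_of_summands idT incT.
exists N => n leNn; apply/esym.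
have /subsemimoduleP[T0 _ _] := modT N.
apply: (direct_sum_cancel T0 _ (sumT N)); last by rewrite -(statT n).
apply: (homo_leq (r := fun A B => B `<=` A) _ _ decI leNn).
  exact: @subset_refl.
by move=> A B C sAB sCA; apply: subset_trans sCA sAB.
Qed.

End SummandSemiring.

Theorem theorem2p13 (S : nzSemiRingType)
    (hS : forall I : set S^o, subtractive_left_ideal I -> direct_summand I) :
  left_k_artinian S /\ left_k_noetherian S.
Proof.
split; first exact: left_k_artinian_of_summands.
exact: left_k_noetherian_of_summands.
Qed.
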